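(* Let $d$, $n$, $a$ be positive integers with $1 \leq a \leq d+1$. Then $$h_d^{(a)}(n)=f_d^{(a)}(n).$$ Moreover, for every positive integer $\lambda$, the number of partitions counted by $h_d^{(a)}(n)$ with exactly $\lambda$ parts equals the number of partitions counted by $f_d^{(a)}(n)$ with largest part $a+(d+1)(\lambda-1)$; namely, for all positive integers $\alpha,\lambda$ (with $n=\alpha+\lambda-1$), $$h_d^{(a)}(\alpha, \lambda)=f_d^{(a)}\bigl(a+(d+1)(\lambda-1),\ \alpha-a-d(\lambda-1)+1\bigr).$$
   Context: A partition $\pi$ is a finite nonempty nonincreasing sequence of positive integers, called its parts. Its perimeter is (largest part of $\pi$) $+$ (number of parts of $\pi$) $-\,1$. A partition is $d$-distinct if any two consecutive parts $\pi_i\ge \pi_{i+1}$ satisfy $\pi_i-\pi_{i+1}\geq d$. For positive integers $n,a,d$: - $h_d^{(a)}(n)$ is the number of partitions with perimeter $n$ whose parts are $d$-distinct and all $\geq a$; - $f_d^{(a)}(n)$ is the number of partitions with perimeter $n$ whose parts are all $\equiv a \pmod{d+1}$. For integers $\alpha,\lambda$: - $h_d^{(a)}(\alpha,\lambda)$ is the number of partitions with largest part $\alpha$ and exactly $\lambda$ parts (hence perimeter $\alpha+\lambda-1$) whose parts are $d$-distinct and all $\geq a$; - $f_d^{(a)}(\alpha,\lambda)$ is the number of partitions with largest part $\alpha$ and exactly $\lambda$ parts (hence perimeter $\alpha+\lambda-1$) whose parts are all $\equiv a \pmod{d+1}$. In particular these counts are $0$ when no such partition exists (e.g. when $\lambda\le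 0$). *)

(* Defs.v *)
From mathcomp Require Import all_boot all_order all_algebra.
From mathcomp Require Import finmap.
From mathcomp Require Import boolp classical_sets functions cardinality.

Set Implicit Arguments.
Unset Strict Implicit.
Unset Printing Implicit Defensive.

Local Open Scope classical_set_scope.
Local Open Scope nat_scope.

Definition is_partition (s : seq nat) : bool :=
  [&& s != [::], sorted geq s & all (leq 1) s].

Definition largest_part (s : seq nat) : nat := \max_(x <- s) x.

Definition perimeter (s : seq nat) : nat := largest_part s + size s - 1.

(* The subtraction is truncated, which is harmless on nonincreasing lists. *)
Definition d_distinct (d : nat) (s : seq nat) : bool :=
  sorted (fun x y => d <= x - y) s.

Definition h_partition (d a : nat) (s : seq nat) : bool :=
  [&& is_partition s, d_distinct d s & all (leq a) s].

Definition f_partition (d a : nat) (s : seq nat) : bool :=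
  is_partition s && all (fun x => x == a %[mod d + 1]) s.

(* [fset_set] returns the empty set on infinite sets; all the sets counted below
   are finite, by [finite_perimeter] and [finite_largest_size]. *)
Definition set_card (A : set (seq nat)) : nat := #|` fset_set A|%fset.

Definition h_perim (d a n : nat) : nat :=
  set_card [set s | h_partition d a s /\ perimeter s = n].

Definition f_perim (d a n : nat) : nat :=
  set_card [set s | f_partition d a s /\ perimeter s = n].

(* The two size parameters are integers because the second one can be zero or
   negative in the refined identity; the count is then 0. *)
Definition h_refined (d a : nat) (alpha lambda : int) : nat :=
  set_card [set s | [/\ h_partition d a s, Posz (largest_part s) = alpha
                   & Posz (size s) = lambda]].

Definition f_refined (d a : nat) (alpha lambda : int) : nat :=
  set_card [set s | [/\ f_partition d a s, Posz (largest_part s) = alpha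
                   & Posz (size s) = lambda]].

Lemma finite_bounded (m k : nat) :
  finite_set [set s : seq nat | size s <= k /\ all (fun x => x <= m) s].
Proof.
elim: k => [|k IHk].
  apply: (@sub_finite_set _ _ [set [::]]); last exact: finite_set1.
  by move=> s /= [+ _]; rewrite leqn0 => /nilP.
apply: (@sub_finite_set _ _ ([set [::]] `|`
  [set x :: s | x in `I_m.+1 &
                s in [set s : seq nat | size s <= k /\ all (fun x => x <= m) s]])).
  move=> [|x s] /= [sz /= al]; first by left.
  by case/andP: al => xm al; right; exists x => //; exists s.
rewrite finite_setU; split; first exact: finite_set1.
by apply: finite_image2 => //; exact: finite_II.
Qed.

Lemma largest_partP (s : seq nat) : all (fun x => x <= largest_part s) s.
Proof. by apply/allP => x xs; rewrite /largest_part; exact: leq_bigmax_seq. Qed.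

Lemma finite_perimeter (P : pred (seq nat)) (n : nat) :
  finite_set [set s | P s /\ perimeter s = n].
Proof.
apply: sub_finite_set (finite_bounded n.+1 n.+1) => s /= [_ sn].
have le_n : largest_part s + size s <= n.+1 by rewrite -sn /perimeter subn1 leqSpred.
split; first by apply: leq_trans le_n; rewrite leq_addl.
apply: sub_all (largest_partP s) => x xs.
by apply: leq_trans le_n; apply: leq_trans xs _; rewrite leq_addr.
Qed.

Lemma finite_largest_size (P : pred (seq nat)) (alpha lambda : int) :
  finite_set [set s | [/\ P s, Posz (largest_part s) = alpha
                        & Posz (size s) = lambda]].
Proof.
apply: sub_finite_set (finite_bounded `|alpha|%N `|lambda|%N) => s /= [_ <- <-].
by split => //; exact: largest_partP.
Qed.

(* Main.v *)
Require Import Defs.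
From mathcomp Require Import all_boot all_order all_algebra.
From mathcomp Require Import boolp classical_sets.
From mathcomp Require Import cardinality zify.

(* Read a partition from its smallest part up: a lattice walk starts at [a], and
   each letter of a binary word either advances the current value or records it
   as a part and then advances it; the final value is the largest part.  For
   d-distinct partitions the letters are "advance by 1" and "record, advance by
   d"; for partitions into parts congruent to a modulo d+1 they are "record,
   advance by 0" and "advance by d+1".  A word with m letters of the first kind
   and t of the second gives largest part a+m+dt and t+1 parts in the first
   reading, largest part a+(d+1)t and m+1 parts in the second, so sharing the
   word is a bijection that proves all the identities at once. *)

Local Open Scope classical_set_scope.
Local Open Scope card_scope.
Local Open Scope nat_scope.

(** [false] advances by [k]; [true] records, then advances by [e]. The d-distinct reading has
    [k = 1], [e = d], the congruence reading [k = d + 1], [e = 0]. *)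
Fixpoint walk (k e x : nat) (w : seq bool) : seq nat :=
  match w with
  | [::] => [:: x]
  | true :: w' => x :: walk k e (x + e) w'
  | false :: w' => walk k e (x + k) w'
  end.

Definition gap (k e : nat) : rel nat :=
  fun x y => (x + e <= y) && (k %| y - (x + e)).

(** This characterizes the image of [walk k e x]. The first part is compared with [x] at shift 0,
    since nothing has been recorded before it. *)
Definition gapped (k e x : nat) (s : seq nat) : bool :=
  if s is y :: s' then gap k 0 x y && path (gap k e) y s' else false.

Lemma gap_refl (k : nat) : reflexive (gap k 0).
Proof. by move=> x; rewrite /gap addn0 leqnn subnn dvdn0. Qed.

Lemma gapE (k x y : nat) : gap k 0 x y = (x <= y) && (y == x %[mod k]).
Proof. by rewrite /gap addn0; case: leqP => //= xy; rewrite eqn_mod_dvd. Qed.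

Lemma gap_trans (k : nat) : transitive (gap k 0).
Proof.
move=> y x z; rewrite !gapE => /andP[xy /eqP yx] /andP[yz /eqP zy].
by rewrite (leq_trans xy yz) zy yx eqxx.
Qed.

Lemma gap_shift (k e x y : nat) : gap k 0 (x + e) y = gap k e x y.
Proof. by rewrite /gap addn0. Qed.

Lemma gap_step (k x : nat) : gap k 0 x (x + k).
Proof. by rewrite /gap addn0 leq_addr addKn dvdnn. Qed.

Lemma walk_gapped (k e x : nat) (w : seq bool) : gapped k e x (walk k e x w).
Proof.
elim: w x => [|[] w IHw] x /=; first by rewrite gap_refl.
  rewrite gap_refl /=.
  by move: (IHw (x + e)); case: walk => //= y s; rewrite gap_shift.
move: (IHw (x + k)); case: walk => //= y s /andP[xy ->].
by rewrite (gap_trans _ _ _ _ (gap_step k x) xy).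
Qed.

Lemma walk_nseq (k e x j : nat) (w : seq bool) :
  walk k e x (nseq j false ++ w) = walk k e (x + j * k) w.
Proof.
elim: j x => [|j IHj] x /=; first by rewrite mul0n addn0.
by rewrite IHj mulSn addnA.
Qed.

(** The quotient of each gap by [k] is the number of letters [false] to insert before the next part
    is recorded. *)
Lemma gapped_walk (k e x : nat) (s : seq nat) :
  gapped k e x s -> exists w, walk k e x w = s.
Proof.
case: s => // y s /=; elim: s x y => [|z s IHs] x y /=;
  rewrite {1}/gap addn0 -andbA => /and3P[xy /dvdnP[j yx]].
  move=> _; exists (nseq j false ++ [::]).
  by rewrite walk_nseq -yx subnKC.
move=> /andP[yz zs].
have /IHs[w wE] : gap k 0 (y + e) z && path (gap k e) z s by rewrite gap_shift yz.
by exists (nseq j false ++ true :: w); rewrite walk_nseq -yx subnKC //= wE.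
Qed.

Lemma size_walk (k e x : nat) (w : seq bool) :
  size (walk k e x w) = (count_mem true w).+1.
Proof. by elim: w x => [|[] w IHw] x //=; rewrite IHw. Qed.

Lemma largest_part_walk (k e x : nat) (w : seq bool) :
  largest_part (walk k e x w)
  = x + k * count_mem false w + e * count_mem true w.
Proof.
rewrite /largest_part; elim: w x => [|[] w IHw] x /=.
- by rewrite big_seq1 !muln0 !addn0.
- rewrite big_cons IHw !add0n mulnDr muln1 -!addnA (maxn_idPr (leq_addr _ _)).
  by rewrite [e + _]addnCA.
- by rewrite IHw !add0n mulnDr muln1 !addnA.
Qed.

(** The first letter can be read off: after [true] the list starts with [x], after [false] its head
    is at least [x + k > x]. *)
Lemma walk_inj (k e x : nat) : 0 < k -> injective (walk k e x).
Proof.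
move=> k_gt0 w1 w2.
have head_ge y w : y <= head y (walk k e y w).
  move: (walk_gapped k e y w); case: walk => //= z s.
  by rewrite gapE => /andP[/andP[]].
have absurd y w s : walk k e (y + k) w <> y :: s.
  move=> E; move: (walk_gapped k e (y + k) w); rewrite E /= gapE; lia.
elim: w1 w2 x => [|b1 w1 IHw] [|b2 w2] x //=.
- case: b2 => /= E; last by case: (absurd x w2 [::]).
  by have := congr1 size E; rewrite /= size_walk.
- case: b1 => /= E; last by case: (absurd x w1 [::]).
  by have := congr1 size E; rewrite /= size_walk.
case: b1 b2 => [] [] /= E.
- by case: E => /IHw ->.
- by case: (absurd x w2 _ (esym E)).
- by case: (absurd x w1 _ E).
- by rewrite (IHw _ _ E).
Qed.

Lemma h_partition_rev (d a : nat) (s : seq nat) : 1 <= d -> 1 <= a ->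
  h_partition d a (rev s) = gapped 1 d a s.
Proof.
move=> hd ha; rewrite /h_partition /is_partition /d_distinct !rev_sorted !all_rev.
rewrite -!size_eq0 size_rev; case: s => //= y s.
have gap1 x z : gap 1 d x z = (x + d <= z) by rewrite /gap dvd1n andbT.
rewrite gapE !modn1 eqxx andbT (eq_path gap1).
(* Since [1 <= d], the truncated difference reaches [d] only if [x < z]. *)
have -> : path (fun x z => d <= z - x) y s = path (fun x z => x + d <= z) y s.
  by apply: eq_path => x z; lia.
have [ds|] := boolP (path (fun x z => x + d <= z) y s); rewrite ?andbF //=.
have ys : path leq y s by apply: sub_path ds => x z; lia.
have /allP ys' := order_path_min leq_trans ys.
rewrite (ys : path (fun x z => geq z x) y s) /= andbT.
have [ay|] := leqP a y; rewrite ?andbF //=.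
rewrite (leq_trans ha ay) /=.
by apply/andP; split; apply/allP => x /ys' yx; lia.
Qed.

Lemma f_partition_rev (d a : nat) (s : seq nat) : 1 <= a -> a <= d + 1 ->
  f_partition d a (rev s) = gapped (d + 1) 0 a s.
Proof.
move=> ha had; rewrite /f_partition /is_partition !rev_sorted !all_rev.
rewrite -!size_eq0 size_rev; case: s => // y s.
rewrite [RHS]/=; apply/idP/idP.
  move=> /andP[/and3P[_ ys]] /andP[y1 _] am.
  have /andP[ya sa] := am.
  have -> /= : gap (d + 1) 0 a y.
    (* A positive [y < a] congruent to [a] would make [d + 1] divide [a - y], which lies strictly
       between 0 and [d + 1]. *)
    rewrite gapE ya andbT leqNgt; apply/negP => lt_ya.
    move: ya; rewrite eq_sym eqn_mod_dvd; last exact: ltnW.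
    by move=> /dvdn_leq; lia.
  apply: (@sub_in_path _ (fun x => x == a %[mod d + 1]) leq) am ys.
  move=> x z /eqP xa /eqP za xz; rewrite gapE za xa eqxx andbT; exact: xz.
move=> /andP[ay ys].
have am : all (gap (d + 1) 0 a) (y :: s).
  by apply: order_path_min; [exact: gap_trans | rewrite /= ay].
apply/andP; split; last by apply: sub_all am => x; rewrite gapE => /andP[].
apply/and3P; split=> //.
  by apply: sub_path ys => x z; rewrite gapE => /andP[].
by apply: sub_all am => x; rewrite gapE => /andP[ax _]; exact: leq_trans ax.
Qed.

Lemma largest_part_rev (s : seq nat) : largest_part (rev s) = largest_part s.
Proof. by rewrite /largest_part (perm_big s) //= perm_rev. Qed.

Definition h_word (d a : nat) (w : seq bool) : seq nat := rev (walk 1 d a w).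

(** Letters are negated because the letter that records a part in one reading is the plain advance
    in the other. *)
Definition f_word (d a : nat) (w : seq bool) : seq nat :=
  rev (walk (d + 1) 0 a (map negb w)).

Lemma count_negb (b : bool) (w : seq bool) :
  count_mem b (map negb w) = count_mem (~~ b) w.
Proof. by rewrite count_map; apply: eq_count => c /=; case: b c => [] []. Qed.

(** [A] and [B] are both equinumerous with one and the same preimage in [T]; finiteness passes from
    [A] to [B] along the way. *)
Lemma set_card_eq (T : Type) (f g : T -> seq nat) (A B : set (seq nat)) :
  injective f -> injective g -> A `<=` range f -> B `<=` range g ->
  (forall w, A (f w) <-> B (g w)) -> finite_set A -> set_card A = set_card B.
Proof.
move=> f_inj g_inj Af Bg AB [m Am].
have preim (h : T -> seq nat) (C : set (seq nat)) :
    injective h -> C `<=` range h -> C #= (h @^-1` C).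
  move=> h_inj Ch; have {1}<- : h @` (h @^-1` C) = C.
    apply/seteqP; split=> [_ [w Cw <-] //|s Cs].
    by have [w _ ws] := Ch _ Cs; exists w; rewrite ?/preimage /= ws.
  by apply: inj_card_eq => x y _ _ /h_inj.
rewrite /set_card (card_fset_set Am); apply/esym/card_fset_set.
apply: card_eq_trans (preim g B g_inj Bg) _.
have <- : f @^-1` A = g @^-1` B by apply/seteqP; split=> w /AB.
by apply: card_eq_trans Am; rewrite card_eq_sym; exact: preim.
Qed.

(** [P] and [Q] stand for the statistics being fixed, so that each of the three identities reduces
    to arithmetic on letter counts. *)
Lemma h_f_set_card (d a : nat) (P Q : set (seq nat)) :
  1 <= d -> 1 <= a -> a <= d + 1 ->
  (forall w, P (h_word d a w) <-> Q (f_word d a w)) ->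
  finite_set [set s | h_partition d a s /\ P s] ->
  set_card [set s | h_partition d a s /\ P s]
  = set_card [set s | f_partition d a s /\ Q s].
Proof.
move=> hd ha had PQ; apply: (set_card_eq _ (h_word d a) (f_word d a)).
- by move=> x y /(can_inj revK) /walk_inj; exact.
- move=> x y /(can_inj revK) /walk_inj E.
  by apply: (inj_map negb_inj); apply: E; rewrite addn1.
- move=> s [hs _]; rewrite -[s]revK h_partition_rev // in hs.
  by have [w ws] := gapped_walk _ _ _ _ hs; exists w; rewrite // /h_word ws revK.
- move=> s [hs _]; rewrite -[s]revK f_partition_rev // in hs.
  have [w ws] := gapped_walk _ _ _ _ hs; exists (map negb w) => //.
  by rewrite /f_word (mapK negbK) ws revK.
move=> w; rewrite /= h_partition_rev // f_partition_rev // !walk_gapped.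
by split=> -[_ /PQ].
Qed.

Lemma h_word_size (d a : nat) (w : seq bool) :
  size (h_word d a w) = (count_mem true w).+1.
Proof. by rewrite size_rev size_walk. Qed.

Lemma f_word_size (d a : nat) (w : seq bool) :
  size (f_word d a w) = (count_mem false w).+1.
Proof. by rewrite size_rev size_walk count_negb. Qed.

Lemma h_word_largest (d a : nat) (w : seq bool) :
  largest_part (h_word d a w) = a + count_mem false w + d * count_mem true w.
Proof. by rewrite largest_part_rev largest_part_walk mul1n. Qed.

Lemma f_word_largest (d a : nat) (w : seq bool) :
  largest_part (f_word d a w) = a + (d + 1) * count_mem true w.
Proof. by rewrite largest_part_rev largest_part_walk !count_negb mul0n addn0. Qed.

(** With [m] letters [false] and [t] letters [true], both sides are [a + m + (d + 1) * t]. *)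
Lemma perimeter_word (d a : nat) (w : seq bool) :
  perimeter (h_word d a w) = perimeter (f_word d a w).
Proof.
rewrite /perimeter h_word_size f_word_size h_word_largest f_word_largest; lia.
Qed.

Theorem theorem1p4 (d n a : nat) (hd : 1 <= d) (hn : 1 <= n)
    (ha : 1 <= a) (had : a <= d + 1) :
  [/\ h_perim d a n = f_perim d a n,
      (forall lambda : nat, 1 <= lambda ->
         set_card [set s | [/\ h_partition d a s, perimeter s = n
                          & size s = lambda]]
         = set_card [set s | [/\ f_partition d a s, perimeter s = n
                            & largest_part s = a + (d + 1) * (lambda - 1)]])
    & (forall alpha lambda : int, (0 < alpha)%R -> (0 < lambda)%R ->
         h_refined d a alpha lambda
         = f_refined d a (Posz a + (Posz d + 1) * (lambda - 1))%R
             (alpha - Posz a - Posz d * (lambda - 1) + 1)%R)].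
Proof.
have set_card_and3 (P Q R : seq nat -> Prop) :
    set_card [set s | [/\ P s, Q s & R s]] = set_card [set s | P s /\ (Q s /\ R s)].
  by congr set_card; apply/seteqP; split=> s [? //=] [].
split.
- apply: (h_f_set_card d a (fun s => perimeter s = n)) => //; last exact: finite_perimeter.
  by move=> w; rewrite perimeter_word.
- move=> lambda lambda_gt0; rewrite !set_card_and3.
  apply: (h_f_set_card d a (fun s => perimeter s = n /\ size s = lambda)) => //.
    move=> w; rewrite perimeter_word h_word_size f_word_largest.
    (* Cancelling [d + 1 > 0] leaves [lambda - 1] letters [true]; the subtraction is exact as
       [1 <= lambda]. *)
    have -> : (a + (d + 1) * count_mem true w = a + (d + 1) * (lambda - 1))
           <-> ((count_mem true w).+1 = lambda) by nia.
    by [].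
  apply: sub_finite_set (finite_perimeter (h_partition d a) n).
  by move=> s [hs []].
move=> alpha lambda alpha_gt0 lambda_gt0.
rewrite /h_refined /f_refined !set_card_and3; apply: h_f_set_card => //.
  move=> w; rewrite h_word_size f_word_size h_word_largest f_word_largest.
  (* On each side one equation fixes the number of [true] letters as [lambda - 1]; the other then
     fixes the number of [false] letters as [alpha - a - d * (lambda - 1)]. *)
  move: (count_mem _ w) (count_mem _ w) => m t; nia.
apply: sub_finite_set (finite_largest_size (h_partition d a) alpha lambda).
by move=> s [hs []].
Qed.
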